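(* Under the standing assumptions (A1) and (A2) of the context, let $R\in\mathcal{M}$ be a local minimizer of the factorized subproblem $\min_{R\in\mathcal{M}}\Psi_k(R)$ which is rank-deficient, i.e. $\operatorname{rank}(R)<p$. Then $R$ is a global minimizer of $\min_{R\in\mathcal{M}}\Psi_k(R)$.
   Context: $\mathbb{S}^n$ is the space of real symmetric $n\times n$ matrices, $\langle A,B\rangle=\operatorname{tr}(A^TB)$, $\|\cdot\|_F$ is the Frobenius norm. Given are $A_1,\dots,A_m,B_1,\dots,B_{m_0}\in\mathbb{S}^n$, $b\in\mathbb{R}^m$, $b_0\in\mathbb{R}^{m_0}$; $\mathcal{A}(X)=(\operatorname{tr}(A_iX))_{i=1}^m$, $\mathcal{B}(X)=(\operatorname{tr}(B_iX))_{i=1}^{m_0}$. Set $\mathcal{D}=\{X\in\mathbb{S}^n: X\succeq 0,\ \mathcal{B}(X)=b_0\}$ and, for a fixed positive integer $p$, $\mathcal{M}=\{R\in\mathbb{R}^{p\times n}:\mathcal{B}(R^TR)=b_0\}$. The underlying problem is $\min_{X\in\mathcal{D}} f(X)+h(X)$ subject to $\mathcal{A}(X)=b$. Standing assumptions. (A1) This problem has a low-rank optimal solution (no specific rank bound is prescribed) and its objective is bounded from below; $f:\mathbb{S}^n\to\mathbb{R}$ is convex and twice differentiable with Lipschitz continuous gradient; $h:\mathbb{S}^n\to\mathbb{R}\cup\{+\infty\}$ is convex, lower semicontinuous and proper. (A2) For every $X\in\mathcal{D}$ the matrices $B_1X,\dots,B_{m_0}X$ are linearly independent, and $\mathcal{M}$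 is a compact embedded submanifold of $\mathbb{R}^{p\times n}$. Subproblem. Fix $y^k\in\mathbb{R}^m$, $Z^k\in\mathbb{S}^n$, $\sigma_k>0$. Let $h^*$ be the convex conjugate of $h$, $\operatorname{prox}_g(W)=\operatorname{argmin}_{V\in\mathbb{S}^n} g(V)+\frac12\|V-W\|_F^2$, and $T(X)=\sigma_k^{-1}\operatorname{prox}_{\sigma_kh^*}(\sigma_kX-Z^k)$. Then $$\Phi_k(X)=f(X)+h\big(X-Z^k/\sigma_k-T(X)\big)+\tfrac{\sigma_k}{2}\big(\|\mathcal{A}(X)-b-y^k/\sigma_k\|_2^2+\|T(X)\|_F^2\big),\qquad \Psi_k(R)=\Phi_k(R^TR).$$ *)

(* Defs.v *)
From HB Require Import structures.
From mathcomp Require Import all_boot all_order all_algebra.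
From mathcomp Require Import all_classical all_reals all_analysis.
From mathcomp Require Import ring lra.
Set Implicit Arguments.
Unset Strict Implicit.
Unset Printing Implicit Defensive.
Import Order.TTheory GRing.Theory Num.Theory.
Import numFieldNormedType.Exports.
Local Open Scope classical_set_scope.
Local Open Scope ring_scope.

Section Frobenius.
Variables (R : realType) (m n : nat).
Implicit Types A B : 'M[R]_(m, n).

Definition fdot A B : R := \tr (A^T *m B).

(* On column vectors (n = 1) this is the Euclidean norm. *)
Definition fnorm A : R := Num.sqrt (fdot A A).

Lemma fdotE A B : fdot A B = \sum_j \sum_i A i j * B i j.
Proof.
by apply: eq_bigr => j _; rewrite mxE; apply: eq_bigr => i _; rewrite mxE.
Qed.

Lemma fdotC A B : fdot A B = fdot B A.
Proof.
by rewrite !fdotE; apply: eq_bigr => j _; apply: eq_bigr => i _; rewrite mulrC.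
Qed.

Lemma fdotDl A B C : fdot (A + B) C = fdot A C + fdot B C.
Proof. by rewrite /fdot raddfD mulmxDl raddfD. Qed.

Lemma fdotZl a A B : fdot (a *: A) B = a * fdot A B.
Proof. by rewrite /fdot linearZ /= -scalemxAl linearZ. Qed.

Lemma fdot0l A : fdot 0 A = 0.
Proof. by rewrite -(scale0r A) fdotZl mul0r. Qed.

Lemma fdot_ge0 A : 0 <= fdot A A.
Proof.
rewrite fdotE; apply: sumr_ge0 => j _; apply: sumr_ge0 => i _.
by rewrite -expr2 sqr_ge0.
Qed.

Lemma fdot_eq0 A : fdot A A = 0 -> A = 0.
Proof.
rewrite fdotE => /eqP.
rewrite psumr_eq0 => [/allP h|j _]; last first.
  by apply: sumr_ge0 => i _; rewrite -expr2 sqr_ge0.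
apply/matrixP => i j; rewrite mxE; apply/eqP.
have := h j (mem_index_enum _); rewrite /= psumr_eq0 => [/allP/(_ i)|k _].
  by rewrite mem_index_enum -expr2 sqrf_eq0 => /(_ isT).
by rewrite -expr2 sqr_ge0.
Qed.

Lemma fdot_CS A B : fdot A B <= fnorm A * fnorm B.
Proof.
have AB0 a b : 0 <= a ^+ 2 * fdot A A - a * b * fdot A B *+ 2
    + b ^+ 2 * fdot B B.
  suff <- : fdot (a *: A - b *: B) (a *: A - b *: B) =
      a ^+ 2 * fdot A A - a * b * fdot A B *+ 2 + b ^+ 2 * fdot B B.
    exact: fdot_ge0.
  rewrite -scaleNr fdotDl !fdotZl ![fdot _ (_ + _)]fdotC !fdotDl !fdotZl.
  rewrite [fdot B A]fdotC; ring.
have [A0|/eqP A0] := eqVneq (fnorm A) 0.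
  have -> : A = 0.
    apply: fdot_eq0; move/eqP: A0; rewrite sqrtr_eq0 => A0.
    by apply/eqP; rewrite eq_le A0 fdot_ge0.
  by rewrite fdot0l mulr_ge0 ?sqrtr_ge0.
have [B0|/eqP B0] := eqVneq (fnorm B) 0.
  have -> : B = 0.
    apply: fdot_eq0; move/eqP: B0; rewrite sqrtr_eq0 => B0.
    by apply/eqP; rewrite eq_le B0 fdot_ge0.
  by rewrite fdotC fdot0l mulr_ge0 ?sqrtr_ge0.
have a0 : 0 < fnorm A by rewrite lt_neqAle sqrtr_ge0 andbT eq_sym; exact/eqP.
have b0 : 0 < fnorm B by rewrite lt_neqAle sqrtr_ge0 andbT eq_sym; exact/eqP.
have := AB0 (fnorm B) (fnorm A).
rewrite -(sqr_sqrtr (fdot_ge0 A)) -(sqr_sqrtr (fdot_ge0 B)) -/(fnorm A).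
rewrite -/(fnorm B) => h.
have {}h : 0 <= (fnorm A * fnorm B) * (fnorm A * fnorm B - fdot A B) by lra.
by move: h; rewrite pmulr_rge0 ?mulr_gt0 // subr_ge0.
Qed.

Lemma fnormD A B : fnorm (A + B) <= fnorm A + fnorm B.
Proof.
rewrite -(@ler_pXn2r _ 2) // ?nnegrE ?addr_ge0 ?sqrtr_ge0 //.
rewrite sqr_sqrtr ?fdot_ge0 // fdotDl ![fdot _ (_ + _)]fdotC !fdotDl.
rewrite [fdot B A]fdotC sqrrD !sqr_sqrtr ?fdot_ge0 //.
have := fdot_CS A B; lra.
Qed.

Lemma fnormZ a A : fnorm (a *: A) = `|a| * fnorm A.
Proof.
rewrite /fnorm fdotZl fdotC fdotZl mulrA -expr2.
by rewrite sqrtrM ?sqr_ge0 // sqrtr_sqr.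
Qed.

Lemma fnorm_eq0 A : fnorm A = 0 -> A = 0.
Proof.
move/eqP; rewrite sqrtr_eq0 => A0; apply: fdot_eq0.
by apply/eqP; rewrite eq_le A0 fdot_ge0.
Qed.

End Frobenius.

Section SymmetricMatrices.
Variables (R : realType) (n : nat).

Record symmx := SymMx { mxval :> 'M[R]_n; _ : mxval \is symmetricmx }.

HB.instance Definition _ := [isSub for mxval].
HB.instance Definition _ := [Choice of symmx by <:].

Lemma symmetricmxE (A : 'M[R]_n) : (A \is symmetricmx) = (A^T == A).
Proof. by rewrite qualifE /= expr0 scale1r map_mx_id // eq_sym. Qed.

Fact symmx_submod_closed :
  submod_closed [pred A : 'M[R]_n | A \is symmetricmx].
Proof.
split; first by rewrite inE symmetricmxE trmx0.
move=> a A B; rewrite !inE !symmetricmxE => /eqP As /eqP Bs.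
by rewrite linearP /= As Bs.
Qed.

HB.instance Definition _ := @GRing.SubChoice_isSubLmodule.Build R 'M[R]_n
  (fun A => A \is symmetricmx) symmx symmx_submod_closed.

Lemma fnorm_mxval_eq0 (X : symmx) : fnorm (mxval X) = 0 -> X = 0.
Proof. by move=> /fnorm_eq0 X0; apply/val_inj; rewrite raddf0. Qed.

(* [symmx] is normed by the Frobenius norm. *)
HB.instance Definition _ := @Lmodule_isNormed.Build R symmx
  (fun X => fnorm (mxval X))
  (fun X Y => fnormD (mxval X) (mxval Y))
  (fun a X => fnormZ a (mxval X))
  fnorm_mxval_eq0.

End SymmetricMatrices.

Section Optimization.

Definition is_argmin (R : realType) (T : Type) (F : T -> \bar R) : set T :=
  [set x | forall y, (F x <= F y)%E].

Definition global_minimizer (R : realType) (T : Type) (D : set T)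
    (F : T -> \bar R) (x : T) : Prop :=
  D x /\ forall y, D y -> (F x <= F y)%E.

Definition local_minimizer (R : realType) (T : topologicalType) (D : set T)
    (F : T -> \bar R) (x : T) : Prop :=
  D x /\ \forall y \near x, D y -> (F x <= F y)%E.

(* The endpoints t = 0, 1 are harmless: 0 * +oo = 0 in [\bar R]. *)
Definition convex_efun (R : realType) (E : lmodType R) (h : E -> \bar R) :
    Prop :=
  forall (X Y : E) (t : R), 0 <= t <= 1 ->
    (h (t *: X + (1 - t) *: Y)%R <= t%:E * h X + (1 - t)%:E * h Y)%E.

(* [h] does not take the value -oo, and is not identically +oo. *)
Definition proper_efun (R : realType) (T : Type) (h : T -> \bar R) : Prop :=
  (forall X, h X != -oo%E) /\ (exists X, h X \is a fin_num).

End Optimization.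

Section Smoothness.
Variable R : realType.

(* C^k on an open subset of a finite-dimensional space: all the iterated
   directional derivatives of order at most k exist and are continuous. *)
Fixpoint class_C (E F : normedModType R) (k : nat) (U : set E) (g : E -> F) :
    Prop :=
  match k with
  | 0 => forall x, U x -> {for x, continuous g}
  | k'.+1 => (forall x, U x -> differentiable g x) /\
             forall v : E, class_C k' U (fun x => 'd g x v)
  end.

Definition smooth_on (E F : normedModType R) (U : set E) (g : E -> F) : Prop :=
  forall k, class_C k U g.

(* A smooth embedded submanifold (of codimension k) of a finite-dimensional
   space, given around each of its points by a local defining function: a
   smooth map with values in R^k whose differential has full rank k and whose
   zero set is the submanifold. *)
Definition embedded_submanifold (E : normedModType R) (M : set E) : Prop :=
  exists k : nat, forall x, M x ->
    exists (U : set E) (g : E -> 'cV[R]_k),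
      [/\ open U, U x, smooth_on U g,
          M `&` U = [set y | U y /\ g y = 0] &
          range ('d g x) = setT].

End Smoothness.

Section Semidefinite.
Variables (R : realType) (n : nat).
Local Notation Sn := (symmx R n).
Implicit Types X V W Z : Sn.

Definition psd X : Prop :=
  forall u : 'cV[R]_n, 0 <= (u^T *m mxval X *m u) 0 0.

Lemma gram_subproof (p : nat) (Q : 'M[R]_(p, n)) : Q^T *m Q \is symmetricmx.
Proof. by rewrite symmetricmxE trmx_mul trmxK. Qed.

Definition gram (p : nat) (Q : 'M[R]_(p, n)) : Sn := SymMx (gram_subproof Q).

Definition trace_map (k : nat) (C : 'I_k -> Sn) (X : Sn) : 'cV[R]_k :=
  \col_i \tr (mxval (C i) *m mxval X).

(* [G] is the gradient of [f] on the Euclidean space S^n. *)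
Definition is_gradient (f : Sn -> R) (G : Sn -> Sn) : Prop :=
  forall X, differentiable f X /\ forall H, 'd f X H = fdot (mxval (G X)) H.

Definition twice_diff_lip_grad (f : Sn -> R) : Prop :=
  exists G : Sn -> Sn,
    [/\ is_gradient f G, forall X, differentiable G X & lipschitz G].

Definition conjugate (h : Sn -> \bar R) (Y : Sn) : \bar R :=
  ereal_sup [set ((fdot (mxval X) Y)%:E - h X)%E | X in [set: Sn]].

(* [`| _ |] is the Frobenius norm. [xget] selects the minimizer, which exists
   and is unique when [g] is convex, lower semicontinuous and proper. *)
Definition prox (g : Sn -> \bar R) (W : Sn) : Sn :=
  xget 0 (is_argmin (fun V => (g V + (2^-1 * `|V - W| ^+ 2)%:E)%E)).

Section Problem.
Variables (m m0 : nat) (A : 'I_m -> Sn) (B : 'I_m0 -> Sn).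
Variables (b : 'cV[R]_m) (b0 : 'cV[R]_m0) (f : Sn -> R) (h : Sn -> \bar R).

Definition setD_sdp : set Sn := [set X | psd X /\ trace_map B X = b0].

Definition setM_sdp (p : nat) : set 'M[R]_(p, n) :=
  [set Q | trace_map B (gram Q) = b0].
Arguments setM_sdp p : clear implicits.

Definition feasible_sdp : set Sn := [set X | setD_sdp X /\ trace_map A X = b].

Definition objective_sdp (X : Sn) : \bar R := ((f X)%:E + h X)%E.

(* [r] is the rank bound of the low-rank solution; following the convention
   for extended-valued problems, an optimal solution has a finite value. *)
Definition assumption_A1 (r : nat) : Prop :=
  [/\ exists X, [/\ global_minimizer feasible_sdp objective_sdp X,
                    objective_sdp X \is a fin_num &
                    (\rank (mxval X) <= r)%N],
      exists c : R, forall X, feasible_sdp X -> (c%:E <= objective_sdp X)%E,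
      convex_function setT f /\ twice_diff_lip_grad f &
      [/\ convex_efun h, lower_semicontinuous h & proper_efun h]].

Definition assumption_A2 (p : nat) : Prop :=
  [/\ forall X, setD_sdp X -> free [tuple mxval (B i) *m mxval X | i < m0],
      compact (setM_sdp p) &
      embedded_submanifold (setM_sdp p)].

Variables (y : 'cV[R]_m) (Z : Sn) (sigma : R).

Definition Tmap (X : Sn) : Sn :=
  sigma^-1 *: prox (fun V => (sigma%:E * conjugate h V)%E) (sigma *: X - Z).

Definition Phi (X : Sn) : \bar R :=
  ((f X)%:E + h (X - sigma^-1 *: Z - Tmap X)%R
   + (sigma / 2 * (fnorm (trace_map A X - b - sigma^-1 *: y) ^+ 2
                   + `|Tmap X| ^+ 2))%:E)%E.

Definition Psi (p : nat) (Q : 'M[R]_(p, n)) : \bar R := Phi (gram Q).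

End Problem.

End Semidefinite.

Arguments setM_sdp {R n m0} B b0 p.
Arguments Psi {R n m} A b f h y Z sigma p Q.

(* Main.v *)
(* Moreau's decomposition writes T(X) = sigma^-1 prox_{sigma h^*}(sigma X - Z) as
   X - Z / sigma - U, where U is the proximal point of h / sigma at
   X - Z / sigma. Hence the h-part of Phi is a Moreau envelope, and Phi is
   finite and convex, with a gradient G at every point.

   Let X = Q^T Q. If Q^T U + U^T Q = 0 and D = U^T U + (Q^T H + H^T Q) satisfies
   B(D) = 0, then the linear independence of the B_i X yields feasible points
   Q + t U + t^2 H + O(t^3) with Gram matrix X + t^2 D + O(t^3); local
   minimality gives <G, D> >= 0, without second derivatives of Phi. The case
   U = 0 is the first-order condition. When rank Q < p, every U = u^T w with
   u Q = 0 is allowed, and adding up over the rows w of Q' gives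
   <G, Q'^T Q' - X> >= 0, so convexity of Phi concludes. *)
Require Import Defs.
From HB Require Import structures.
From mathcomp Require Import all_boot all_order all_algebra.
From mathcomp Require Import all_classical all_reals all_analysis.
From mathcomp Require Import ring lra.
Set Implicit Arguments.
Unset Strict Implicit.
Unset Printing Implicit Defensive.
Import Order.TTheory GRing.Theory Num.Theory.
Import numFieldNormedType.Exports.
Local Open Scope classical_set_scope.
Local Open Scope ring_scope.

(** A negative [a] is contradicted by t = - a / (|c| + 1 - a), which lies in (0, 1]. This replaces
    the passages to the limit t -> 0 below. *)
Lemma ge0_of_small_perturbation (R : realType) (a c : R) :
  (forall t, 0 < t <= 1 -> 0 <= a + t * c) -> 0 <= a.
Proof.
move=> h; rewrite leNgt; apply/negP => a0.
have c0 : 0 < `|c| + 1 - a by rewrite subr_gt0 (lt_trans a0) // ltr_wpDl.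
have t01 : 0 < - a / (`|c| + 1 - a) <= 1.
  by rewrite divr_gt0 ?oppr_gt0 //= ler_pdivrMr // mul1r lerDr addr_ge0.
have := h _ t01; rewrite leNgt => /negP; apply.
have -> : a + - a / (`|c| + 1 - a) * c =
    a * (`|c| + 1 - a - c) / (`|c| + 1 - a).
  by field; rewrite gt_eqF.
rewrite pmulr_llt0 ?invr_gt0 // nmulr_rlt0 //.
have := ler_norm c; lra.
Qed.

(** * Frobenius norm estimates and comparison with the maximum norm *)

Section FrobeniusBounds.
Variables (R : realType).

Lemma fdotDr m n (A B C : 'M[R]_(m, n)) : fdot A (B + C) = fdot A B + fdot A C.
Proof. by rewrite fdotC fdotDl !(fdotC _ A). Qed.

Lemma fnorm_ge0 m n (A : 'M[R]_(m, n)) : 0 <= fnorm A.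
Proof. exact: sqrtr_ge0. Qed.

Lemma fnorm_sqr m n (A : 'M[R]_(m, n)) : fnorm A ^+ 2 = fdot A A.
Proof. by rewrite sqr_sqrtr // fdot_ge0. Qed.

Lemma fnormN m n (A : 'M[R]_(m, n)) : fnorm (- A) = fnorm A.
Proof. by rewrite -scaleN1r fnormZ normrN1 mul1r. Qed.

Lemma fnorm0 m n : fnorm (0 : 'M[R]_(m, n)) = 0.
Proof. by rewrite /fnorm fdot0l sqrtr0. Qed.

Lemma fnorm_tr m n (A : 'M[R]_(m, n)) : fnorm A^T = fnorm A.
Proof. by rewrite /fnorm /fdot trmxK mxtrace_mulC. Qed.

Lemma fdot_normr m n (A B : 'M[R]_(m, n)) : `|fdot A B| <= fnorm A * fnorm B.
Proof.
rewrite ler_norml fdot_CS andbT lerNl -mulN1r -fdotZl scaleN1r.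
by rewrite -(fnormN A) fdot_CS.
Qed.

Lemma fnorm_sum m n (I : finType) (F : I -> 'M[R]_(m, n)) :
  fnorm (\sum_i F i) <= \sum_i fnorm (F i).
Proof.
elim/big_ind2 : _ => [|A a B b Aa Bb|//]; first by rewrite fnorm0.
by rewrite (le_trans (fnormD _ _)) // lerD.
Qed.

(** By Cauchy-Schwarz each entry of the product is at most the norm of a row of [A] times the norm
    of a column of [B]; the squares of these bounds sum to the product of the squared norms. *)
Lemma fnorm_mulmx m n p (A : 'M[R]_(m, n)) (B : 'M[R]_(n, p)) :
  fnorm (A *m B) <= fnorm A * fnorm B.
Proof.
rewrite -(@ler_pXn2r _ 2) ?nnegrE ?mulr_ge0 ?fnorm_ge0 // exprMn !fnorm_sqr.
have entry j i : (A *m B) i j ^+ 2 <=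
    fdot (row i A) (row i A) * fdot (col j B) (col j B).
  have -> : (A *m B) i j = fdot (row i A)^T (col j B).
    rewrite fdotE big_ord1 mxE; apply: eq_bigr => k _; by rewrite !mxE.
  rewrite -!fnorm_sqr -exprMn -(fnorm_tr (row i A)) -real_normK ?num_real //.
  by rewrite ler_pXn2r ?nnegrE ?mulr_ge0 ?fnorm_ge0 // fdot_normr.
rewrite fdotE.
apply: (@le_trans _ _ (\sum_j \sum_i
    fdot (row i A) (row i A) * fdot (col j B) (col j B))).
  by apply: ler_sum => j _; apply: ler_sum => i _; rewrite -expr2.
under eq_bigr do rewrite -mulr_suml.
rewrite -mulr_sumr; apply: ler_pM; rewrite ?fdot_ge0 //.
- by apply: sumr_ge0 => i _; exact: fdot_ge0.
- by apply: sumr_ge0 => i _; exact: fdot_ge0.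
- rewrite (fdotE A) [leRHS]exchange_big /=; apply: ler_sum => i _.
  by rewrite fdotE; apply: ler_sum => j _; rewrite big_ord1 !mxE.
- rewrite (fdotE B); apply: ler_sum => i _.
  by rewrite fdotE big_ord1; apply: ler_sum => j _; rewrite !mxE.
Qed.

Lemma norm_entry m n (A : 'M[R]_(m, n)) i j : `|A i j| <= `|A|.
Proof.
by rewrite [leRHS]/Num.norm /= mx_normrE; apply: (le_bigmax _ _ (i, j)).
Qed.

Lemma entry_fnorm m n (A : 'M[R]_(m, n)) i j : `|A i j| <= fnorm A.
Proof.
rewrite -(@ler_pXn2r _ 2) ?nnegrE ?fnorm_ge0 //.
rewrite fnorm_sqr real_normK ?num_real // fdotE.
rewrite (bigD1 j) //= (bigD1 i) //= -expr2 -addrA lerDl addr_ge0 //.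
  by apply: sumr_ge0 => k _; rewrite -expr2 sqr_ge0.
by apply: sumr_ge0 => k _; apply: sumr_ge0 => l _; rewrite -expr2 sqr_ge0.
Qed.

(** On plain matrices [|A|] is the maximum norm, which governs their topology; this bound and
    [fnorm_le_norm] carry estimates between it and [fnorm]. *)
Lemma norm_le_fnorm m n (A : 'M[R]_(m, n)) : `|A| <= fnorm A.
Proof.
rewrite [leLHS]/Num.norm /= mx_normrE; apply/bigmax_leP.
by split=> [|[i j] _]; [exact: fnorm_ge0|exact: entry_fnorm].
Qed.

Lemma fnorm_le_norm m n (A : 'M[R]_(m, n)) : fnorm A <= (n * m)%:R * `|A|.
Proof.
rewrite {1}(matrix_sum_delta A).
rewrite (le_trans (fnorm_sum _)) //.
apply: (@le_trans _ _ (\sum_(i < m) n%:R * `|A|)); last first.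
  rewrite sumr_const card_ord -[X in X <= _]mulr_natl natrM mulrA.
  by rewrite (mulrC m%:R).
apply: ler_sum => i _; rewrite (le_trans (fnorm_sum _)) //.
rewrite -[n in n%:R]card_ord mulr_natl -sumr_const; apply: ler_sum => j _.
rewrite fnormZ -[leRHS]mulr1 ler_pM ?norm_entry ?fnorm_ge0 //.
rewrite -(@ler_pXn2r _ 2) ?nnegrE ?fnorm_ge0 // fnorm_sqr /fdot trmx_delta.
by rewrite mul_delta_mx /mxtrace (bigD1 j) //= big1 => [|k /negPf kj];
  rewrite mxE ?eqxx ?addr0 ?expr1n // kj.
Qed.

End FrobeniusBounds.

(** * The Euclidean space of symmetric matrices and its completeness *)

Section SymmetricInnerProduct.
Variables (R : realType) (n : nat).
Local Notation Sn := (symmx R n).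
Implicit Types X Y Z : Sn.

Definition sdot X Y : R := fdot (mxval X) (mxval Y).

Lemma mxval_inj : injective (@mxval R n).
Proof. exact: val_inj. Qed.

Lemma mxvalD X Y : mxval (X + Y) = mxval X + mxval Y.
Proof. exact: (raddfD (val : Sn -> _)). Qed.

Lemma mxvalZ a X : mxval (a *: X) = a *: mxval X.
Proof. exact: (linearZZ (val : Sn -> _)). Qed.

Lemma mxvalN X : mxval (- X) = - mxval X.
Proof. exact: (raddfN (val : Sn -> _)). Qed.

Lemma mxval_sum (I : finType) (F : I -> Sn) :
  mxval (\sum_i F i) = \sum_i mxval (F i).
Proof. exact: (raddf_sum (val : Sn -> _)). Qed.

Lemma mxval_tr X : (mxval X)^T = mxval X.
Proof. by apply/eqP; rewrite -symmetricmxE; case: X. Qed.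

Lemma sdotC X Y : sdot X Y = sdot Y X.
Proof. exact: fdotC. Qed.

Lemma sdotDl X Y Z : sdot (X + Y) Z = sdot X Z + sdot Y Z.
Proof. by rewrite /sdot mxvalD fdotDl. Qed.

Lemma sdotZl a X Y : sdot (a *: X) Y = a * sdot X Y.
Proof. by rewrite /sdot mxvalZ fdotZl. Qed.

Lemma sdotNl X Y : sdot (- X) Y = - sdot X Y.
Proof. by rewrite -scaleN1r sdotZl mulN1r. Qed.

Lemma sdotDr X Y Z : sdot X (Y + Z) = sdot X Y + sdot X Z.
Proof. by rewrite !(sdotC X) sdotDl. Qed.

Lemma sdotZr a X Y : sdot X (a *: Y) = a * sdot X Y.
Proof. by rewrite !(sdotC X) sdotZl. Qed.

Lemma sdotNr X Y : sdot X (- Y) = - sdot X Y.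
Proof. by rewrite !(sdotC X) sdotNl. Qed.

Definition sdotE := (sdotDl, sdotDr, sdotZl, sdotZr, sdotNl, sdotNr).

Lemma sdot_suml (I : finType) (F : I -> Sn) X :
  sdot (\sum_i F i) X = \sum_i sdot (F i) X.
Proof.
elim/big_ind2 : _ => [|? ? ? ? <- <-|//]; last by rewrite sdotDl.
by rewrite -(scale0r X) sdotZl mul0r.
Qed.

Lemma normS X : `|X| = fnorm (mxval X). Proof. by []. Qed.

Lemma sqr_normS X : `|X| ^+ 2 = sdot X X.
Proof. exact: fnorm_sqr. Qed.

Lemma sqr_normB X Y : `|X - Y| ^+ 2 = sdot X X - 2 * sdot X Y + sdot Y Y.
Proof.
rewrite sqr_normS !sdotE (sdotC Y X).
by move: (sdot X X) (sdot X Y) (sdot Y Y) => a b c; ring.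
Qed.

(** The parallelogram law. The weights 2^-1 and 1 - 2^-1 match the convex combination with t = 2^-1
    in [convex_efun_fin]. *)
Lemma sqr_norm_midpoint X Y Z : `|2^-1 *: X + (1 - 2^-1) *: Y - Z| ^+ 2 =
  2^-1 * `|X - Z| ^+ 2 + 2^-1 * `|Y - Z| ^+ 2 - 4^-1 * `|X - Y| ^+ 2.
Proof.
have -> : 2^-1 *: X + (1 - 2^-1) *: Y - Z = 2^-1 *: ((X - Z) + (Y - Z)).
  rewrite (_ : 1 - 2^-1 = 2^-1); last by field.
  rewrite addrACA -opprD scalerBr scalerDr -[Z + Z]mulr2n.
  by rewrite -[Z *+ 2]scaler_nat scalerA mulVf ?scale1r // pnatr_eq0.
have -> : X - Y = (X - Z) - (Y - Z) by rewrite opprB addrA subrK.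
move: (X - Z) (Y - Z) => U V; rewrite !sqr_normS !sdotE (sdotC V U).
by move: (sdot U U) (sdot U V) (sdot V V) => a b c; field.
Qed.

Lemma sdot_ge0 X : 0 <= sdot X X.
Proof. exact: fdot_ge0. Qed.

Lemma normr_sdot X Y : `|sdot X Y| <= `|X| * `|Y|.
Proof. exact: fdot_normr. Qed.

Lemma sdot_trace X Y : sdot X Y = \tr (mxval X *m mxval Y).
Proof. by rewrite /sdot /fdot mxval_tr. Qed.

(** The limit exists in the complete space of all matrices; it is symmetric because entries
    converge, and the equivalence of norms brings the convergence back to [symmx]. *)
Lemma symmx_cauchy_cvg (u : nat -> Sn) :
  (forall e : R, 0 < e -> exists N, forall i j, (N <= i)%N -> (N <= j)%N ->
     `|u i - u j| < e) ->
  cvgn u.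
Proof.
move=> uC.
have : cvgn (fun k => mxval (u k)).
  apply/cauchy_cvgP/cauchy_ballP => e e0; near_simpl; have [N uN] := uC _ e0.
  exists ([set i | (N <= i)%N], [set i | (N <= i)%N]); first by split; exists N.
  move=> [i j] [/= Ni Nj]; rewrite -ball_normE /=.
  apply: le_lt_trans (norm_le_fnorm _) _.
  by have := uN i j Ni Nj; rewrite normS mxvalD mxvalN.
move=> /cvg_ex[/= L uL].
have entry i j : (mxval (u k)) i j @[k --> \oo] --> L i j.
  apply/cvgrPdist_lt => e e0; move/cvgrPdist_lt: uL => /(_ e e0).
  apply: filterS => k /=; apply: le_lt_trans.
  by have := norm_entry (L - mxval (u k)) i j; rewrite !mxE.
have symL : L \is symmetricmx.
  rewrite symmetricmxE; apply/eqP/matrixP => i j; rewrite mxE.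
  have E k : (mxval (u k)) j i = (mxval (u k)) i j.
    by rewrite -mxval_tr mxE mxval_tr.
  have := entry j i; under eq_fun do rewrite E.
  move=> /(cvg_lim (@Rhausdorff R)) <-.
  exact: (cvg_lim (@Rhausdorff R) (entry i j)).
apply/cvg_ex; exists (SymMx symL); apply/cvgrPdist_lt => e e0.
(* The added 1 keeps the divisor of e positive when n = 0. *)
have c0 : 0 < (n * n)%:R + 1 :> R by rewrite ltr_wpDl.
have := uL; move/cvgrPdist_lt => /(_ (e / ((n * n)%:R + 1))).
rewrite divr_gt0 // => /(_ isT); apply: filterS => k /= uk.
rewrite normS mxvalD mxvalN /=; apply: le_lt_trans (fnorm_le_norm _) _.
rewrite ltr_pdivlMr // mulrC in uk; apply: le_lt_trans uk.
by rewrite ler_wpM2r // lerDl.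
Qed.

End SymmetricInnerProduct.

(** * Proximal points, conjugates and Moreau's decomposition *)

Section Proximal.
Variables (R : realType) (n : nat).
Local Notation Sn := (symmx R n).
Variable h : Sn -> \bar R.
Hypothesis h_convex : convex_efun h.
Hypothesis h_lsc : lower_semicontinuous h.
Hypothesis h_proper : proper_efun h.

Lemma proper_cases X : h X = +oo%E \/ exists x : R, h X = x%:E.
Proof.
by have := h_proper.1 X; case: (h X) => [x _|_|//]; [right; exists x|left].
Qed.

Lemma convex_efun_fin X Y (x y t : R) :
  h X = x%:E -> h Y = y%:E -> 0 <= t <= 1 ->
  exists2 z, h (t *: X + (1 - t) *: Y) = z%:E & z <= t * x + (1 - t) * y.
Proof.
move=> hX hY t01; have := h_convex X Y t01; rewrite hX hY.
have [->//|[z ->]] := proper_cases (t *: X + (1 - t) *: Y).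
by rewrite -!EFinM -EFinD lee_fin => ?; exists z.
Qed.

(* Lower semicontinuity bounds h below on a small ball around a point of its
   domain; convexity spreads this to a linear lower bound. *)
Lemma convex_lsc_linear_bound :
  exists X0 a c, 0 <= c /\ forall X, ((a - c * `|X - X0|)%:E <= h X)%E.
Proof.
have [X0] := h_proper.2; rewrite fin_numE => /andP[_ hX0oo].
have [hX0|[x0 hX0]] := proper_cases X0; first by rewrite hX0 in hX0oo.
have : ((x0 - 1)%:E < h X0)%E by rewrite hX0 lte_fin; lra.
move=> /h_lsc[V] /nbhs_normP[d /= d0 dV] Vh.
exists X0, (x0 - 1), (2 / d); split; first by rewrite divr_ge0 // ltW.
move=> X; have [->|[x hX]] := proper_cases X; first by rewrite leey.
rewrite hX lee_fin.
have [dX|dX] := ltP `|X - X0| d.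
  have : ((x0 - 1)%:E < h X)%E.
    by apply/Vh/dV; rewrite /ball_ /= distrC.
  rewrite hX lte_fin => x0x.
  by have : 0 <= 2 / d * `|X - X0|;
    [rewrite mulr_ge0 // divr_ge0 // ltW|lra].
set rho := `|X - X0|; have rho0 : 0 < rho by exact: lt_le_trans dX.
have drho : d / rho <= 1 by rewrite ler_pdivrMr // mul1r.
(* This t places t X + (1 - t) X0 at distance d / 2 from X0, inside the ball where h > x0 - 1. *)
set t := d / (2 * rho).
have tE : t = d / rho / 2 by rewrite /t; field; rewrite gt_eqF.
have t0 : 0 < t by rewrite divr_gt0 // mulr_gt0.
have t01 : 0 <= t <= 1 by rewrite ltW //=; lra.
have [z hz zle] := convex_efun_fin hX hX0 t01.
have : ((x0 - 1)%:E < h (t *: X + (1 - t) *: X0)%R)%E.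
  apply/Vh/dV; rewrite /ball_ /= distrC.
  have -> : t *: X + (1 - t) *: X0 - X0 = t *: (X - X0).
    by rewrite scalerBl scale1r scalerBr addrA addrAC addrK.
  rewrite normrZ gtr0_norm // tE -/rho.
  have -> : d / rho / 2 * rho = d / 2 by field; rewrite gt_eqF.
  lra.
rewrite hz lte_fin => x0z.
have : x0 - 1 < t * x + (1 - t) * x0 by exact: lt_le_trans zle.
move=> H; have H1 : 0 < t * (x - x0 + t^-1).
  rewrite mulrDr mulfV ?gt_eqF //; lra.
rewrite pmulr_rgt0 // in H1.
have : t^-1 = 2 / d * rho by rewrite /t; field; rewrite !gt_eqF.
lra.
Qed.

Lemma quadratic_bounded_below (s c : R) : 0 < s ->
  exists m, forall r : R, m <= s * r ^+ 2 - c * r.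
Proof.
move=> s0; exists (- (c ^+ 2 / (4 * s))) => r.
have -> : s * r ^+ 2 - c * r = s * (r - c / (2 * s)) ^+ 2 - c ^+ 2 / (4 * s).
  by field; rewrite gt_eqF.
by rewrite lerDr mulr_ge0 ?sqr_ge0 // ltW.
Qed.

(** The arithmetic of the Cauchy estimate: two points nearly attain the infimum mu, and their
    midpoint cannot fall below it, so they are close. *)
Let midpoint_arith (s z x y mu a b p q r : R) :
  z <= 2^-1 * x + (1 - 2^-1) * y -> x + s * p < mu + a -> y + s * q < mu + b ->
  mu <= z + s * (2^-1 * p + 2^-1 * q - 4^-1 * r) -> s / 4 * r <= (a + b) / 2.
Proof. by move=> *; lra. Qed.

Section Minimization.
Variables (s : R) (W : Sn).
Hypothesis s0 : 0 < s.

(** Only points where h is finite enter, so the infimum is one of real numbers. *)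
Let value : set R :=
  [set v | exists X x, h X = x%:E /\ v = x + s * `|X - W| ^+ 2].

(** The quadratic term dominates the linear lower bound of h, once that bound is recentred from X1
    to W by the triangle inequality. *)
Lemma prox_value_has_inf : has_inf value.
Proof.
have [X0 hX0] := h_proper.2; split.
  exists (fine (h X0) + s * `|X0 - W| ^+ 2), X0, (fine (h X0)).
  by rewrite fineK.
have [X1 [a [c [c0 ha]]]] := convex_lsc_linear_bound.
have [m hm] := quadratic_bounded_below c s0.
exists (a + m - c * `|W - X1|) => _ [X [x [hX ->]]].
have := ha X; rewrite hX lee_fin => ax.
have : c * `|X - X1| <= c * (`|X - W| + `|W - X1|).
  by rewrite ler_wpM2l // ler_distD.
have := hm `|X - W|.
move: (`|X - X1|) (`|X - W|) (`|W - X1|) ax => u v w; lra.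
Qed.

(** The direct method: strong convexity makes a minimizing sequence Cauchy, without compactness, and
    lower semicontinuity shows that its limit attains the infimum. *)
Lemma prox_exists : exists U u, h U = u%:E /\
  forall X x, h X = x%:E -> u + s * `|U - W| ^+ 2 <= x + s * `|X - W| ^+ 2.
Proof.
have hinf := prox_value_has_inf; set mu := inf value.
have mule X x : h X = x%:E -> mu <= x + s * `|X - W| ^+ 2.
  by move=> hX; apply: (ge_inf hinf.2); exists X, x.
have ex (k : nat) : exists Xx : Sn * R, h Xx.1 = (Xx.2)%:E /\
    Xx.2 + s * `|Xx.1 - W| ^+ 2 < mu + k.+1%:R^-1.
  have k0 : 0 < k.+1%:R^-1 :> R by rewrite invr_gt0.
  by have [_ [X [x [hX ->]]] lt] := inf_adherent k0 hinf; exists (X, x).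
have [v vP] := choice ex; pose X k := (v k).1.
have close i j : s / 4 * `|X i - X j| ^+ 2 <= (i.+1%:R^-1 + j.+1%:R^-1) / 2.
  have [[hi li] [hj lj]] := (vP i, vP j).
  have t01 : 0 <= (2^-1 : R) <= 1 by lra.
  have [z hz zle] := convex_efun_fin hi hj t01.
  have := mule _ _ hz; rewrite -/(X i) -/(X j) in li lj *.
  by rewrite sqr_norm_midpoint => m_le; exact: (midpoint_arith zle li lj m_le).
have Xcvg : cvgn X.
  apply: symmx_cauchy_cvg => e e0.
  have se0 : 0 < s / 4 * e ^+ 2 by rewrite mulr_gt0 ?divr_gt0 ?exprn_gt0.
  have [N _ hN] := near_infty_natSinv_lt (PosNum se0).
  exists N => i j Ni Nj; have := close i j.
  have /= := hN i Ni; have /= := hN j Nj => aj ai le.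
  rewrite -(@ltr_pXn2r _ 2) ?nnegrE ?(ltW e0) //.
  rewrite -(@ltr_pM2l _ (s / 4)) ?divr_gt0 //.
  by apply: (le_lt_trans le); rewrite ltr_pdivrMr // mulr_natr mulr2n ltrD.
move: Xcvg => /cvg_ex[U XU].
(* These numbers bound h (X k) from above, so their limit must bound h U. *)
have value_cvg : mu + k.+1%:R^-1 - s * `|X k - W| ^+ 2 @[k --> \oo] -->
    mu - s * `|U - W| ^+ 2.
  apply: cvgB; last first.
    apply: cvgMl_tmp; rewrite expr2; under eq_fun do rewrite expr2.
    by apply: cvgM; apply: cvg_norm; apply: cvgB => //; exact: cvg_cst.
  rewrite -[X in _ --> X]addr0; apply: cvgD; first exact: cvg_cst.
  exact: cvg_harmonic.
have hU : (h U <= (mu - s * `|U - W| ^+ 2)%:E)%E.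
  rewrite leNgt; apply/negP => lt.
  (* A real threshold strictly between the limit and h U, which may still be +oo at this stage. *)
  have [a [lta ah]] : exists a, mu - s * `|U - W| ^+ 2 < a /\ (a%:E < h U)%E.
    have [hU|[u hU]] := proper_cases U.
      by exists (mu - s * `|U - W| ^+ 2 + 1); rewrite hU ltry; split => //; lra.
    exists ((mu - s * `|U - W| ^+ 2 + u) / 2).
    by move: lt; rewrite hU !lte_fin => lt; split; lra.
  have [V UV Vh] := h_lsc ah.
  move: lta; rewrite ltNge => /negP; apply.
  apply: (cvgr_to_ge value_cvg); near=> k.
  have /Vh : V (X k) by near: k; exact: XU.
  have [hk lk] := vP k; rewrite /X hk lte_fin lerBrDr => /ltW ak.
  by rewrite (le_trans _ (ltW lk)) // lerD2r.
have [hU'|[u hU']] := proper_cases U; first by rewrite hU' in hU.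
move: hU; rewrite hU' lee_fin lerBrDr => hU.
exists U, u; split; first exact: hU'.
by move=> Y y hY; exact: le_trans hU (mule Y y hY).
Unshelve. all: by end_near. Qed.
End Minimization.

(** Minimality of U is tested against t X + (1 - t) U. After division by t the quadratic error is t
    s |X - U|^2, which vanishes with t. *)
Lemma prox_subgradient (s u : R) (U W : Sn) : 0 < s -> h U = u%:E ->
  (forall X x, h X = x%:E -> u + s * `|U - W| ^+ 2 <= x + s * `|X - W| ^+ 2) ->
  forall X, ((u + 2 * s * sdot (W - U) (X - U))%:E <= h X)%E.
Proof.
move=> s0 hU Umin X; have [->|[x hX]] := proper_cases X.
  by rewrite leey.
rewrite hX lee_fin addrC -lerBrDr -subr_ge0.
apply: (@ge0_of_small_perturbation _ _ (s * sdot (X - U) (X - U))) => t t01.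
have [t0 _] := andP t01.
have t01' : 0 <= t <= 1 by case/andP: t01 => /ltW -> ->.
have [z hz zle] := convex_efun_fin hX hU t01'.
have := Umin _ _ hz.
have -> : t *: X + (1 - t) *: U - W = t *: (X - U) - (W - U).
  rewrite scalerBl scale1r scalerBr opprB !addrA; congr (_ - _).
  by rewrite addrAC.
rewrite -(opprB W U) normrN [`|W - U| ^+ 2]sqr_normS sqr_normB !sdotZl !sdotZr.
rewrite (sdotC (X - U) (W - U)).
move: (sdot (W - U) (W - U)) (sdot (W - U) (X - U)) (sdot (X - U) (X - U)).
move=> a b c le; rewrite -(pmulr_rge0 _ t0); move: le zle.
by move=> *; nra.
Qed.

(** The equality case of the Fenchel-Young inequality: the subgradient inequality says that U
    attains the supremum. *)
Lemma conjugate_at_subgradient (u : R) (U P : Sn) : h U = u%:E ->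
  (forall X, ((u + sdot P (X - U))%:E <= h X)%E) ->
  conjugate h P = (sdot P U - u)%:E.
Proof.
move=> hU PU; apply/eqP; rewrite eq_le; apply/andP; split; last first.
  by apply: ereal_sup_ubound; exists U => //; rewrite hU -EFinB sdotC.
apply: ge_ereal_sup => _ [X _ <-]; rewrite -/(sdot X P).
have := PU X; have [->|[x ->]] := proper_cases X; first by rewrite leNye.
rewrite -EFinB !lee_fin sdotDr sdotNr (sdotC X).
by move: (sdot P U) (sdot P X) => a b; lra.
Qed.

Lemma conjugate_ge (u : R) (U P : Sn) : h U = u%:E ->
  ((sdot U P - u)%:E <= conjugate h P)%E.
Proof. by move=> hU; apply: ereal_sup_ubound; exists U => //; rewrite hU. Qed.

(* Moreau's decomposition of W along the proximal maps of h / sigma and of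
   sigma h^*. *)
Lemma prox_conjugate (sigma u : R) (U W : Sn) : 0 < sigma -> h U = u%:E ->
  (forall X, ((u + sdot (W - sigma *: U) (X - U))%:E <= h X)%E) ->
  prox (fun V => (sigma%:E * conjugate h V)%E) W = W - sigma *: U.
Proof.
move=> sigma0 hU; have : W = (W - sigma *: U) + sigma *: U by rewrite subrK.
move: (W - sigma *: U) => P PW sub.
have hP := conjugate_at_subgradient hU sub.
have cge V := conjugate_ge V hU.
(* The excess over the value at P is at least half the squared distance to P. This gives both the
   minimality and the uniqueness needed to evaluate [xget]. *)
have strict V : ((sigma * (sdot P U - u) + 2^-1 * `|P - W| ^+ 2
     + 2^-1 * `|V - P| ^+ 2)%:E <=
   sigma%:E * conjugate h V + (2^-1 * `|V - W| ^+ 2)%:E)%E.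
  apply: (@le_trans _ _
      (sigma%:E * (sdot U V - u)%:E + (2^-1 * `|V - W| ^+ 2)%:E)%E); last first.
    by apply: leeD2r; apply: lee_wpmul2l => //; rewrite lee_fin ltW.
  rewrite -EFinM -EFinD lee_fin PW.
  have -> : P - (P + sigma *: U) = - (sigma *: U).
    by rewrite opprD addrA subrr add0r.
  rewrite !sqr_normS.
  rewrite !sdotE.
  rewrite (sdotC V P) (sdotC V U) (sdotC P U).
  move: (sdot U U) (sdot U P) (sdot U V) (sdot V V) (sdot P V) (sdot P P).
  by move=> a b c d e f; rewrite le_eqVlt; apply/orP; left; apply/eqP; field.
apply: xget_unique => [V|V /(_ P)].
  rewrite /= hP; apply: le_trans (strict V).
  rewrite -EFinM -EFinD lee_fin lerDl.
  by rewrite mulr_ge0 // ?invr_ge0 // exprn_ge0.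
rewrite hP => /(le_trans (strict V)).
rewrite -EFinM -EFinD lee_fin gerDl => le.
apply/eqP; rewrite -subr_eq0 -normr_eq0 -sqrf_eq0 eq_le sqr_ge0 andbT.
by rewrite pmulr_rle0 ?invr_gt0 in le.
Qed.

(** With W = X - Z / sigma, the argument of h in [Phi] is the minimizer U of h + (sigma / 2) |. -
    W|^2, and T(X) = W - U. Everything later about T follows from this subgradient inequality. *)
Lemma Tmap_subgradient (Z X : Sn) (sigma : R) : 0 < sigma ->
  exists2 u, h (X - sigma^-1 *: Z - Tmap h Z sigma X) = u%:E &
  forall V, ((u + sigma * sdot (Tmap h Z sigma X)
      (V - (X - sigma^-1 *: Z - Tmap h Z sigma X)))%:E <= h V)%E.
Proof.
move=> sigma0; set W := X - sigma^-1 *: Z.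
have s0 : 0 < sigma / 2 by rewrite divr_gt0.
have [U [u [hU Umin]]] := prox_exists W s0.
have sub V := prox_subgradient s0 hU Umin V.
have s2 : 2 * (sigma / 2) = sigma by field.
have TE : Tmap h Z sigma X = W - U.
  have WE : sigma *: X - Z = sigma *: W.
    by rewrite scalerBr scalerA mulfV ?gt_eqF // scale1r.
  rewrite /Tmap WE (prox_conjugate sigma0 hU) => [|V].
    by rewrite scalerBr !scalerA mulVf ?gt_eqF // !scale1r.
  by have := sub V; rewrite s2 -scalerBr sdotZl.
rewrite TE (_ : W - (W - U) = U); last by rewrite opprB addrCA subrr addr0.
by exists u => // V; have := sub V; rewrite s2.
Qed.

End Proximal.

(** * Gradients of convex functions at a point *)

Section ConvexGradient.
Variables (R : realType) (n : nat).
Local Notation Sn := (symmx R n).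
Implicit Types (X Y G D : Sn) (phi psi : Sn -> R).

(** An affine minorant valid everywhere and a first-order majorant near X: the minorant serves the
    global conclusion, the majorant the comparison along feasible curves. *)
Definition convex_gradient phi X G :=
  (forall Y, phi X + sdot G (Y - X) <= phi Y) /\
  (forall e : R, 0 < e -> exists2 d : R, 0 < d &
     forall D, `|D| < d -> phi (X + D) <= phi X + sdot G D + e * `|D|).

Lemma convex_gradientD phi psi X G H :
  convex_gradient phi X G -> convex_gradient psi X H ->
  convex_gradient (fun Y => phi Y + psi Y) X (G + H).
Proof.
move=> [phige phile] [psige psile]; split=> [Y|e e0].
  by rewrite sdotDl addrACA lerD.
have e2 : 0 < e / 2 by rewrite divr_gt0.
have [d1 d10 d1P] := phile _ e2; have [d2 d20 d2P] := psile _ e2.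
exists (Num.min d1 d2); first by rewrite lt_min d10.
move=> D; rewrite lt_min => /andP[/d1P D1 /d2P D2].
apply: le_trans (lerD D1 D2) _; rewrite sdotDl.
by move: (sdot G D) (sdot H D) `|D| => a b c; lra.
Qed.

Lemma convex_gradient_of_quadratic phi X G (c : R) :
  (forall Y, phi X + sdot G (Y - X) <= phi Y) ->
  (forall D, phi (X + D) <= phi X + sdot G D + c * `|D| ^+ 2) ->
  convex_gradient phi X G.
Proof.
move=> ge le; split=> // e e0; have c0 : 0 < `|c| + 1 by rewrite ltr_wpDl.
exists (e / (`|c| + 1)); first by rewrite divr_gt0.
move=> D; rewrite ltr_pdivlMr // => De; apply: le_trans (le D) _.
rewrite lerD2l expr2 mulrA ler_wpM2r //.
apply: le_trans (ltW De); rewrite mulrC ler_wpM2l // (le_trans (ler_norm c)) //.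
by rewrite lerDl.
Qed.

(** Convexity on the segment from X to Y, used at one small t, gives the minorant up to an error e
    |Y - X|, and e is arbitrary. *)
Lemma convex_gradient_convex_function (f : Sn -> R) (G : Sn -> Sn) X :
  convex_function setT f -> is_gradient f G -> convex_gradient f X (G X).
Proof.
move=> fconv fG; have [fX dfX] := fG X.
have approx (e : R) : 0 < e -> exists2 d : R, 0 < d &
    forall D, `|D| < d -> `|f (X + D) - (f X + sdot (G X) D)| <= e * `|D|.
  move=> e0; have /eqaddoP/(_ e e0)/nbhs_normP[d /= d0 dP] := diff_locally fX.
  exists d => // D Dd; have := dP D; rewrite /ball_ /= sub0r normrN => /(_ Dd).
  by rewrite (addrC X) /sdot -dfX.
split=> [Y|e e0]; last first.
  have [d d0 dP] := approx e e0; exists d => // D /dP.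
  by rewrite ler_norml => /andP[_]; rewrite lerBlDl.
have lower (e : R) : 0 < e -> sdot (G X) (Y - X) <= f Y - f X + e * `|Y - X|.
  move=> e0; have [d d0 dP] := approx e e0.
  have [t /andP[t0 t1] td] : exists2 t : R, 0 < t <= 1 & `|t *: (Y - X)| < d.
    have r0 : 0 < `|Y - X| + d + 1 by rewrite ltr_wpDl // addr_ge0 // ltW.
    (* This choice works for Y = X too, and never exceeds 1. *)
    exists (d / (`|Y - X| + d + 1)).
      rewrite divr_gt0 //= ler_pdivrMr // mul1r addrAC lerDr addr_ge0 //.
    rewrite normrZ gtr0_norm ?divr_gt0 // mulrAC ltr_pdivrMr // ltr_pM2l //.
    by rewrite -addrA ltrDl addr_gt0.
  have := fconv (Itv01 (ltW t0) t1) Y X; rewrite !in_setT => /(_ isT isT).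
  rewrite convRE => conv.
  have {}conv : f (t *: Y + (1 - t) *: X) <= t * f Y + (1 - t) * f X.
    exact: conv.
  have := dP _ td; rewrite normrZ gtr0_norm // sdotZr ler_norml => /andP[+ _].
  have <- : t *: Y + (1 - t) *: X = X + t *: (Y - X).
    rewrite scalerBl scale1r scalerBr addrC -!addrA; congr (_ + _).
    by rewrite addrC.
  move=> le; rewrite -(ler_pM2l t0); move: conv le.
  move: (f (_ + _)) (f Y) (f X) (sdot _ _) `|_| => a b c u v conv le; lra.
rewrite -lerBrDl; apply/ler_addgt0Pr => e e0.
have e1 : 0 < e / (`|Y - X| + 1) by rewrite divr_gt0 // ltr_wpDl.
apply: le_trans (lower _ e1) _; rewrite lerD2l -mulrA ler_piMr ?(ltW e0) //.
by rewrite mulrC ler_pdivrMr ?ltr_wpDl // mul1r lerDl.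
Qed.

End ConvexGradient.

(** * First-order behaviour of the subproblem objective *)

Section PhiFirstOrder.
Variables (R : realType) (n m : nat).
Local Notation Sn := (symmx R n).

Lemma trace_mapD (k : nat) (C : 'I_k -> Sn) X Y :
  trace_map C (X + Y) = trace_map C X + trace_map C Y.
Proof. by apply/colP => i; rewrite !mxE mxvalD mulmxDr raddfD. Qed.

(** The adjoint of the trace map sends v to sum_i v_i C_i. *)
Lemma fdot_trace_map (k : nat) (C : 'I_k -> Sn) (v : 'cV[R]_k) X :
  fdot v (trace_map C X) = sdot (\sum_i v i 0 *: C i) X.
Proof.
rewrite fdotE big_ord1 sdot_suml; apply: eq_bigr => i _.
by rewrite sdotZl sdot_trace mxE.
Qed.

Lemma trace_map_bound (k : nat) (C : 'I_k -> Sn) X :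
  fnorm (trace_map C X) ^+ 2 <= (\sum_i `|C i| ^+ 2) * `|X| ^+ 2.
Proof.
rewrite fnorm_sqr fdotE big_ord1 mulr_suml; apply: ler_sum => i _.
rewrite !mxE -sdot_trace -expr2 -real_normK ?num_real // -exprMn.
by rewrite ler_pXn2r ?nnegrE ?mulr_ge0 // normr_sdot.
Qed.

Lemma convex_gradient_penalty (A : 'I_m -> Sn) (a : 'cV[R]_m) (c : R) X :
  0 <= c ->
  convex_gradient (fun Y => c * fnorm (trace_map A Y - a) ^+ 2) X
    (\sum_i (2 * c * (trace_map A X - a) i 0) *: A i).
Proof.
move=> c0.
have expand D : c * fnorm (trace_map A (X + D) - a) ^+ 2 =
    c * fnorm (trace_map A X - a) ^+ 2
    + sdot (\sum_i (2 * c * (trace_map A X - a) i 0) *: A i) D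
    + c * fnorm (trace_map A D) ^+ 2.
  have -> : trace_map A (X + D) - a = trace_map A X - a + trace_map A D.
    by rewrite trace_mapD addrAC.
  rewrite [X in sdot X D](_ : _ =
    (2 * c) *: \sum_i ((trace_map A X - a) i 0) *: A i).
    rewrite sdotZl -fdot_trace_map !fnorm_sqr.
    move: (trace_map A X - a) (trace_map A D) => v w.
    by rewrite fdotDl !fdotDr (fdotC w v); ring.
  by rewrite scaler_sumr; apply: eq_bigr => i _; rewrite scalerA.
apply: (@convex_gradient_of_quadratic _ _ _ _ _ (c * \sum_i `|A i| ^+ 2)).
  move=> Y; have := expand (Y - X); rewrite (addrC X) subrK => ->.
  by rewrite lerDl mulr_ge0 // sqr_ge0.
by move=> D; rewrite expand lerD2l -mulrA ler_wpM2l // trace_map_bound.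
Qed.

(** The Moreau envelope in abstract form: [sub] says that sigma T(X) is a subgradient at the
    proximal point of X. No continuity of T is assumed. *)
Lemma convex_gradient_envelope (T : Sn -> Sn) (u : Sn -> R) (W : Sn)
    (sigma : R) X :
  0 < sigma ->
  (forall X Y, u X + sigma * sdot (T X) (Y - W - T Y - (X - W - T X)) <= u Y) ->
  convex_gradient (fun Y => u Y + sigma / 2 * `|T Y| ^+ 2) X (sigma *: T X).
Proof.
move=> sigma0 sub; pose env Y := u Y + sigma / 2 * `|T Y| ^+ 2.
have gap X' Y : env X' + sigma * sdot (T X') (Y - X')
    + sigma / 2 * sdot (T Y - T X') (T Y - T X') <= env Y.
  have := sub X' Y; rewrite /env !sqr_normS !sdotE (sdotC (T Y) (T X')).
  move: (sdot (T X') X') (sdot (T X') Y) (sdot (T X') W) (sdot (T X') (T Y))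
    (sdot (T X') (T X')) (sdot (T Y) (T Y)) => a b c d e g le; lra.
rewrite -/env.
apply: (@convex_gradient_of_quadratic _ _ _ _ _ (sigma / 2)) => [Y|D].
  apply: le_trans (gap X Y); rewrite sdotZl lerDl.
  by rewrite mulr_ge0 ?sdot_ge0 // divr_ge0 // ltW.
(* The roles of base point and target are exchanged to get an upper bound at X + D. It involves T (X
   + D) instead of T X; the square introduced next absorbs the difference. *)
have := gap (X + D) X; rewrite opprD addrA subrr sub0r (sqr_normS D).
have : 0 <= sigma * sdot (T (X + D) - T X - D) (T (X + D) - T X - D).
  by rewrite mulr_ge0 ?sdot_ge0 // ltW.
move: (env (X + D)) (env X) (T (X + D)) (T X) => e1 e0 T1 T0; rewrite !sdotE.
rewrite (sdotC T0 T1) (sdotC D T0) (sdotC D T1).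
move: (sdot T0 T0) (sdot T1 T1) (sdot T1 T0) (sdot T0 D) (sdot T1 D) (sdot D D).
by move=> *; lra.
Qed.

(** The gradients of f, of the quadratic penalty and of the envelope add up. [Phi] is finite because
    h is evaluated at a proximal point. *)
Lemma Phi_convex_gradient (A : 'I_m -> Sn) (b : 'cV[R]_m) (f : Sn -> R)
    (h : Sn -> \bar R) (y : 'cV[R]_m) (Z : Sn) (sigma : R) :
  convex_function setT f -> (exists G, is_gradient f G) ->
  convex_efun h -> lower_semicontinuous h -> proper_efun h -> 0 < sigma ->
  exists phi : Sn -> R, (forall X, Phi A b f h y Z sigma X = (phi X)%:E) /\
    forall X, exists G, convex_gradient phi X G.
Proof.
move=> fconv [G fG] h_convex h_lsc h_proper sigma0.
have Tsub := Tmap_subgradient h_convex h_lsc h_proper Z _ sigma0.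
set T := Tmap h Z sigma in Tsub; set W := sigma^-1 *: Z in Tsub.
pose u Y := fine (h (Y - W - T Y)).
have hu X : h (X - W - T X) = (u X)%:E by rewrite /u; have [v ->] := Tsub X.
exists (fun X => f X
   + sigma / 2 * fnorm (trace_map A X - (b + sigma^-1 *: y)) ^+ 2
   + (u X + sigma / 2 * `|T X| ^+ 2)); split=> [X|X].
  rewrite /Phi -/T -/W hu -!EFinD mulrDr opprD addrA; congr EFin.
  by rewrite -!addrA; congr (_ + _); rewrite addrCA.
eexists; apply: convex_gradientD; last first.
  apply: (convex_gradient_envelope (W := W) X sigma0) => X' Y.
  have [v hv /(_ (Y - W - T Y))] := Tsub X'.
  have -> : v = u X' by apply: EFin_inj; rewrite -hv; exact: hu.
  have -> : h (Y - W - T Y) = (u Y)%:E by exact: hu.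
  by rewrite lee_fin.
apply: convex_gradientD; first exact: convex_gradient_convex_function fG.
by apply: convex_gradient_penalty; rewrite divr_ge0 // ltW.
Qed.

End PhiFirstOrder.

(** * Fixed points of small perturbations of a constant map *)

Lemma small_perturbation_fixed_point
    (R : realType) (E : completeNormedModType R)
    (r0 : E) (r : R -> E -> E) (M : R) :
  (forall (t : R) c, 0 < t <= 1 -> `|c| <= `|r0| + 1 -> `|r t c| <= M) ->
  (forall (t : R) c c', 0 < t <= 1 -> `|c| <= `|r0| + 1 -> `|c'| <= `|r0| + 1 ->
     `|r t c - r t c'| <= M * `|c - c'|) ->
  exists2 d : R, 0 < d & forall t, 0 < t < d ->
    exists2 c, `|c| <= `|r0| + 1 & c = r0 + t *: r t c.
Proof.
move=> rM rlip; have K0 : 0 < `|M| + 1 by rewrite ltr_wpDl.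
(* Below this threshold both t <= 1 and t M <= 1/2 hold, whatever the sign of M; the map then
   preserves the ball of radius |r0| + 1 and contracts by 1/2. *)
exists (2 * (`|M| + 1))^-1; first by rewrite invr_gt0 mulr_gt0.
move=> t /andP[t0 td].
have tK : t * (`|M| + 1) <= 2^-1.
  move: td; rewrite invfM -ltr_pdivrMr ?invr_gt0 // invrK => /ltW; lra.
have t1 : t <= 1.
  have : t * 1 <= t * (`|M| + 1) by rewrite ler_wpM2l ?(ltW t0) // lerDr.
  by move: tK; rewrite mulr1 => *; lra.
have t01 : 0 < t <= 1 by rewrite t0.
have tM : t * M <= 2^-1.
  apply: le_trans tK; rewrite ler_wpM2l ?(ltW t0) //.
  by rewrite (le_trans (ler_norm _)) // lerDl.
pose ball := [set c : E | `|c| <= `|r0| + 1].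
pose F c := r0 + t *: r t c.
have Fball : set_fun ball ball F.
  move=> c; rewrite /ball /= => cb; apply: le_trans (ler_normD _ _) _.
  rewrite lerD2l normrZ gtr0_norm // (@le_trans _ _ 2^-1) //; last by lra.
  apply: le_trans tM; rewrite ler_wpM2l ?(ltW t0) //; exact: rM.
have : exists2 c, ball c & c = mkfun_fun Fball c.
  apply: banach_fixed_point.
  - have h20 : 0 <= 2^-1 :> R by [].
    exists (NngNum h20); split=> /=; first by lra.
    move=> [c c'] /= [cb c'b]; rewrite /F opprD addrACA subrr add0r -scalerBr.
    rewrite normrZ gtr0_norm //; apply: le_trans (_ : t * (M * `|c - c'|) <= _).
      by rewrite ler_wpM2l ?(ltW t0) //; exact: rlip.
    by rewrite mulrA ler_wpM2r.
  - rewrite (_ : ball = closed_ball_ Num.norm 0 (`|r0| + 1)).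
      exact: closed_closed_ball_.
    by apply/seteqP; split=> c; rewrite /closed_ball_ /ball /= sub0r normrN.
  - by exists 0; rewrite /ball /= normr0 addr_ge0.
by move=> [c cb cF]; exists c.
Qed.

(** * Polarization of the Gram map *)

Section Cross.
Variables (R : realType) (n p : nat).
Local Notation Sn := (symmx R n).
Implicit Types K L : 'M[R]_(p, n).

Fact cross_subproof K L : K^T *m L + L^T *m K \is symmetricmx.
Proof. by rewrite symmetricmxE raddfD /= !trmx_mul !trmxK addrC. Qed.

(** The differential at K, in the direction L, of the Gram map. *)
Definition cross K L : Sn := SymMx (cross_subproof K L).

Lemma crossC K L : cross K L = cross L K.
Proof. by apply/val_inj; rewrite /= addrC. Qed.

Lemma crossDr K L L' : cross K (L + L') = cross K L + cross K L'.
Proof.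
by apply/val_inj; rewrite /= mulmxDr [(L + L')^T]raddfD /= mulmxDl addrACA.
Qed.

Lemma crossZr a K L : cross K (a *: L) = a *: cross K L.
Proof.
apply/val_inj; rewrite /= [(a *: L)^T]linearZ /=.
by rewrite -scalemxAr -scalemxAl -scalerDr.
Qed.

Lemma crossDl K K' L : cross (K + K') L = cross K L + cross K' L.
Proof. by rewrite crossC crossDr !(crossC L). Qed.

Lemma crossZl a K L : cross (a *: K) L = a *: cross K L.
Proof. by rewrite crossC crossZr crossC. Qed.

Lemma cross0r K : cross K 0 = 0.
Proof. by rewrite -(scale0r 0) crossZr scale0r. Qed.

Lemma crossBr K L L' : cross K (L - L') = cross K L - cross K L'.
Proof. by rewrite crossDr -scaleN1r crossZr scaleN1r. Qed.

Lemma cross_sumr (I : finType) K (F : I -> 'M[R]_(p, n)) :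
  cross K (\sum_i F i) = \sum_i cross K (F i).
Proof.
by elim/big_ind2 : _ => [|? ? ? ? <- <-|//]; rewrite ?cross0r ?crossDr.
Qed.

Lemma gramD K L : gram (K + L) = gram K + cross K L + gram L.
Proof.
apply/val_inj; rewrite /= [(K + L)^T]raddfD /= mulmxDr !mulmxDl -!addrA.
congr (_ + _).
by rewrite addrCA.
Qed.

Lemma gramZ a K : gram (a *: K) = a ^+ 2 *: gram K.
Proof.
apply/val_inj; rewrite /= [(a *: K)^T]linearZ /=.
by rewrite -scalemxAr -scalemxAl scalerA expr2.
Qed.

Lemma gram0 : gram (0 : 'M[R]_(p, n)) = 0.
Proof. by rewrite -(scale0r 0) gramZ expr0n scale0r. Qed.

Lemma crossxx K : cross K K = 2 *: gram K.
Proof. by apply/val_inj; rewrite /= scaler_nat mulr2n. Qed.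

Lemma norm_gram K : `|gram K| <= fnorm K ^+ 2.
Proof. by rewrite normS expr2 (le_trans (fnorm_mulmx _ _)) // fnorm_tr. Qed.

Lemma norm_cross K L : `|cross K L| <= 2 * (fnorm K * fnorm L).
Proof.
rewrite normS; apply: le_trans (fnormD _ _) _; rewrite mulr_natl mulr2n.
rewrite lerD // (le_trans (fnorm_mulmx _ _)) // fnorm_tr //.
by rewrite mulrC.
Qed.

Lemma sdot_cross (S : Sn) K L : sdot S (cross K L) = 2 * fdot (K *m mxval S) L.
Proof.
rewrite sdot_trace /= mulmxDr raddfD /= /fdot trmx_mul mxval_tr -mulmxA.
rewrite -[X in _ + X]mxtrace_tr !trmx_mul trmxK mxval_tr.
by rewrite [X in _ + X]mxtrace_mulC mulr_natl mulr2n.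
Qed.

End Cross.

(** * Linearized constraint and expansion of the Gram matrix along a curve *)

Section Constraint.
Variables (R : realType) (n p m0 : nat).
Local Notation Sn := (symmx R n).
Variables (B : 'I_m0 -> Sn) (Q : 'M[R]_(p, n)).

(* With S = sum_i c_i B_i, the quadratic form of the Gram matrix below at c is
   2 |Q S|^2; if it vanishes then S (Q^T Q) = 0. *)
Lemma constraint_right_inverse :
  free [tuple mxval (B i) *m (Q^T *m Q) | i < m0] ->
  exists V : 'I_m0 -> 'M[R]_(p, n), forall d : 'cV[R]_m0,
    trace_map B (cross Q (\sum_j d j 0 *: V j)) = d.
Proof.
move=> Bfree.
(* Preimages are sought in the span of the Q B_j, which makes M_ij = 2 <Q B_i, Q B_j>, twice a Gram
   matrix. *)
pose W j : 'M[R]_(p, n) := Q *m mxval (B j).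
pose M := \matrix_(i < m0, j < m0) sdot (B i) (cross Q (W j)).
have Munit : M \in unitmx.
  rewrite -row_free_unit -kermx_eq0; apply/rowV0P => c /sub_kermxP cM.
  pose S := \sum_i c 0 i *: B i.
  have QS : Q *m mxval S = \sum_i c 0 i *: W i.
    rewrite mxval_sum mulmx_sumr; apply: eq_bigr => i _.
    by rewrite mxvalZ -scalemxAr.
  have form0 : sdot S (cross Q (Q *m mxval S)) = 0.
    rewrite QS cross_sumr sdotC sdot_suml big1 // => j _.
    rewrite crossZr sdotZl sdotC sdot_suml.
    have := congr1 (fun v : 'rV[R]_m0 => v 0 j) cM; rewrite !mxE => E.
    rewrite (eq_bigr (fun i => c 0 i * M i j)) ?E ?mulr0 // => i _.
    by rewrite sdotZl mxE.
  have QS0 : Q *m mxval S = 0.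
    apply: fdot_eq0; move: form0; rewrite sdot_cross => /eqP.
    by rewrite mulf_eq0 pnatr_eq0 => /eqP.
  have SX0 : \sum_i c 0 i *: (mxval (B i) *m (Q^T *m Q)) = 0.
    transitivity (mxval S *m (Q^T *m Q)).
      rewrite mxval_sum mulmx_suml; apply: eq_bigr => i _.
      by rewrite mxvalZ -scalemxAl.
    by rewrite -mxval_tr mulmxA -trmx_mul QS0 trmx0 mul0mx.
  apply/rowP => i; rewrite mxE; move/freeP: Bfree => /(_ (fun i => c 0 i)) h.
  apply: h; rewrite -[RHS]SX0; apply: eq_bigr => k _.
  by rewrite nth_mktuple.
exists (fun j => \sum_k invmx M k j *: W k) => d.
apply/colP => i; rewrite mxE -sdot_trace cross_sumr sdotC sdot_suml.
transitivity ((M *m (invmx M *m d)) i 0); last first.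
  by rewrite mulmxA mulmxV // mul1mx.
rewrite mulmxA !mxE; apply: eq_bigr => j _.
rewrite crossZr sdotZl mulrC; congr (_ * _).
rewrite cross_sumr sdot_suml mxE; apply: eq_bigr => k _.
by rewrite crossZr sdotZl mxE sdotC mulrC.
Qed.

Lemma trace_mapZ a X : trace_map B (a *: X) = a *: trace_map B X.
Proof. by apply/colP => i; rewrite !mxE mxvalZ -scalemxAr linearZ. Qed.

Lemma trace_mapN X : trace_map B (- X) = - trace_map B X.
Proof. by rewrite -scaleN1r trace_mapZ scaleN1r. Qed.

Lemma trace_map_sum (I : finType) (F : I -> Sn) :
  trace_map B (\sum_i F i) = \sum_i trace_map B (F i).
Proof.
elim/big_ind2 : _ => [|? ? ? ? <- <-|//]; last by rewrite trace_mapD.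
by rewrite -(scale0r 0) trace_mapZ scale0r.
Qed.

Lemma norm_trace_map X :
  `|trace_map B X| <= Num.sqrt (\sum_i `|B i| ^+ 2) * `|X|.
Proof.
apply: le_trans (norm_le_fnorm _) _.
have S0 : 0 <= \sum_i `|B i| ^+ 2 by apply: sumr_ge0 => i _; rewrite sqr_ge0.
rewrite -(@ler_pXn2r _ 2) ?nnegrE ?mulr_ge0 ?fnorm_ge0 ?sqrtr_ge0 //.
by rewrite exprMn (sqr_sqrtr S0) trace_map_bound.
Qed.

Section Curve.
Variables U H : 'M[R]_(p, n).

(** The terms of order at least four in the expansion of [gram_curve], divided by t^4. *)
Definition curve_rest (t : R) (V : 'M[R]_(p, n)) : Sn :=
  gram H + cross U V + t *: cross H V + t ^+ 2 *: gram V.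

(** V first appears at order t^3, and linearly, through [cross Q V]; so once B annihilates the t^2
    term, feasibility is a small perturbation of a linear equation in V. *)
Lemma gram_curve t V : cross Q U = 0 ->
  gram (Q + (t *: U + t ^+ 2 *: H + t ^+ 3 *: V)) =
  gram Q + t ^+ 2 *: (gram U + cross Q H)
  + t ^+ 3 *: (cross Q V + cross U H + t *: curve_rest t V).
Proof.
move=> QU; rewrite gramD !gramD !crossDr !crossDl !crossZr !crossZl !gramZ QU.
rewrite /curve_rest.
move: (gram Q) (gram U) (gram H) (gram V) (cross Q H) (cross Q V) (cross U H).
move: (cross U V) (cross H V) => X1 X2 X3 X4 X5 X6 X7 X8 X9.
apply: mxval_inj; rewrite !(mxvalD, mxvalZ); apply/matrixP => i j.
by rewrite !mxE; ring.
Qed.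

Lemma gramB (V V' : 'M[R]_(p, n)) :
  gram V - gram V' = cross V' (V - V') + gram (V - V').
Proof.
have := gramD (V - V') V'; rewrite subrK crossC => {1}->.
by rewrite [gram _ + cross _ _]addrC addrK.
Qed.

(** The term 4 k comes from gram V - gram V' = cross V' W + gram W with W = V - V' and |W| <= 2 k;
    each summand contributes 2 k |W|. *)
Lemma curve_rest_lipschitz (t k : R) V V' :
  0 < t <= 1 -> fnorm V <= k -> fnorm V' <= k ->
  `|curve_rest t V - curve_rest t V'| <=
    (2 * fnorm U + 2 * fnorm H + 4 * k) * fnorm (V - V').
Proof.
move=> /andP[t0 t1] Vk V'k; rewrite /curve_rest.
have cancel (a b c d b' c' d' : Sn) :
    a + b + c + d - (a + b' + c' + d') = b - b' + (c - c') + (d - d').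
  rewrite opprD addrACA; congr (_ + _); rewrite opprD addrACA; congr (_ + _).
  by rewrite opprD addrACA subrr add0r.
rewrite cancel -crossBr -!scalerBr -crossBr gramB.
have Wk : fnorm (V - V') <= 2 * k.
  by rewrite mulr_natl mulr2n (le_trans (fnormD _ _)) // fnormN lerD.
move: (V - V') Wk => W Wk; have W0 := fnorm_ge0 W.
have k0 : 0 <= k by rewrite (le_trans (fnorm_ge0 V)).
have small (x c : R) (Y : Sn) : 0 <= x <= 1 -> `|Y| <= c -> `|x *: Y| <= c.
  move=> /andP[x0 x1] Yc; rewrite normrZ ger0_norm //.
  by rewrite (le_trans _ Yc) // ler_piMl.
rewrite (mulrDl _ (4 * k)) (mulrDl (2 * _)) -!(mulrA 2) -(mulrA 4).
apply: le_trans (ler_normD _ _) _; apply: lerD.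
  apply: le_trans (ler_normD _ _) _; apply: lerD; first exact: norm_cross.
  by apply: small; [rewrite ltW|exact: norm_cross].
apply: small; first by rewrite sqr_ge0 expr_le1 // ltW.
apply: le_trans (ler_normD _ _) _.
apply: le_trans (lerD (norm_cross _ _) (norm_gram _)) _.
rewrite expr2; have : fnorm V' * fnorm W <= k * fnorm W by rewrite ler_wpM2r.
have : fnorm W * fnorm W <= 2 * k * fnorm W by rewrite ler_wpM2r.
by move: (fnorm W) (fnorm V') => a c; lra.
Qed.

End Curve.

End Constraint.

(** Lets column vectors serve as the complete normed space of the fixed-point lemma. *)
HB.instance Definition _ (R : realType) (m n : nat) := Complete.on 'M[R]_(m, n).

(** * Feasible points with a prescribed second-order Gram increment *)

Section CurveExistence.
Variables (R : realType) (n p m0 : nat).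
Local Notation Sn := (symmx R n).
Variables (B : 'I_m0 -> Sn) (Q : 'M[R]_(p, n)).
Hypothesis Bfree : free [tuple mxval (B i) *m (Q^T *m Q) | i < m0].

(* The third-order correction V is found in the range of a right inverse of
   the derivative of the constraint, by Banach's fixed point theorem. *)
Lemma constraint_curve (U H : 'M[R]_(p, n)) :
  cross Q U = 0 -> trace_map B (gram U + cross Q H) = 0 ->
  exists C d : R, [/\ 0 <= C, 0 < d & forall t, 0 < t < d ->
    exists Q' E, [/\ trace_map B (gram Q') = trace_map B (gram Q),
      `|Q' - Q| <= C * t,
      gram Q' = gram Q + t ^+ 2 *: (gram U + cross Q H) + t ^+ 3 *: E &
      `|E| <= C]].
Proof.
move=> QU D0; have [V hV] := constraint_right_inverse Bfree.
pose N (d : 'cV[R]_m0) := \sum_j d j 0 *: V j.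
pose nu := \sum_j fnorm (V j).
have nu0 : 0 <= nu by apply: sumr_ge0 => j _; exact: fnorm_ge0.
have NB d d' : N d - N d' = N (d - d').
  by rewrite /N -sumrB; apply: eq_bigr => j _; rewrite -scalerBl !mxE.
have Nle d : fnorm (N d) <= nu * `|d|.
  rewrite (le_trans (fnorm_sum _)) // mulr_suml; apply: ler_sum => j _.
  by rewrite fnormZ mulrC ler_wpM2l ?fnorm_ge0 // norm_entry.
pose beta := Num.sqrt (\sum_i `|B i| ^+ 2).
have beta0 : 0 <= beta by exact: sqrtr_ge0.
have bB X : `|trace_map B X| <= beta * `|X| by exact: norm_trace_map.
(* With V = N d, applying B to the t^3 coefficient and equating to zero gives d = r0 + t r(t, d), as
   B (cross Q (N d)) = d. *)
pose r0 : 'cV[R]_m0 := - trace_map B (cross U H).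
pose r (t : R) (d : 'cV[R]_m0) : 'cV[R]_m0 :=
  - trace_map B (curve_rest U H t (N d)).
pose rho := `|r0| + 1; have rho0 : 0 <= rho by rewrite addr_ge0.
pose k := nu * rho; have k0 : 0 <= k by rewrite mulr_ge0.
have Nk d : `|d| <= rho -> fnorm (N d) <= k.
  by move=> dr; apply: le_trans (Nle d) _; rewrite ler_wpM2l.
pose L := 2 * fnorm U + 2 * fnorm H + 4 * k.
have L0 : 0 <= L by rewrite !addr_ge0 // mulr_ge0 // fnorm_ge0.
(* A uniform bound for the rest: its value gram H at V = 0 plus the Lipschitz constant times the
   radius k. *)
pose c1 := `|gram H : Sn| + L * k.
have c10 : 0 <= c1 by rewrite addr_ge0 // mulr_ge0.
have rest_bound t W : 0 < t <= 1 -> fnorm W <= k -> `|curve_rest U H t W| <= c1.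
  move=> t01 Wk.
  have E0 : curve_rest U H t 0 = gram H.
    by rewrite /curve_rest !cross0r gram0 !scaler0 !addr0.
  have := curve_rest_lipschitz U H t01 Wk (V' := 0).
  rewrite fnorm0 E0 subr0 => /(_ k0) le.
  rewrite -(subrK (gram H) (curve_rest _ _ _ _)).
  apply: le_trans (ler_normD _ _) _.
  rewrite addrC lerD2l; apply: le_trans le _.
  by rewrite ler_wpM2l.
have [t c t01 cr|t c c' t01 cr c'r|d d0 fixP] :=
    @small_perturbation_fixed_point _ _ r0 r (beta * c1 + beta * (L * nu)).
- rewrite normrN; apply: le_trans (bB _) _.
  apply: (@le_trans _ _ (beta * c1)); last by rewrite lerDl !mulr_ge0.
  by rewrite ler_wpM2l // rest_bound // Nk.
- rewrite /r opprK addrC -trace_mapN -trace_mapD.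
  apply: le_trans (bB _) _.
  apply: (@le_trans _ _ (beta * (L * nu) * `|c - c'|)); last first.
    by rewrite ler_wpM2r // lerDr mulr_ge0.
  rewrite -mulrA ler_wpM2l // (distrC (curve_rest U H t (N c'))).
  apply: le_trans (curve_rest_lipschitz U H t01 (Nk _ cr) (Nk _ c'r)) _.
  by rewrite -mulrA NB ler_wpM2l.
pose CE := 2 * (fnorm Q * k) + 2 * (fnorm U * fnorm H) + c1.
pose CQ := fnorm U + fnorm H + k.
have CE0 : 0 <= CE by rewrite !addr_ge0 // !mulr_ge0 // fnorm_ge0.
have CQ0 : 0 <= CQ by rewrite !addr_ge0 // fnorm_ge0.
(* One constant covers the error E and the displacement of Q; t < 1 lets the higher powers of t be
   bounded by t. *)
exists (CE + CQ), (Num.min d 1).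
split; [by rewrite addr_ge0|by rewrite lt_min d0 ltr01|].
move=> t; rewrite lt_min => /andP[t0 /andP[td t1]].
have t01 : 0 < t <= 1 by rewrite t0 ltW.
have [|c cr cfix] := fixP t; first by rewrite t0.
have ck := Nk _ cr.
have E := gram_curve H t (N c) QU.
exists (Q + (t *: U + t ^+ 2 *: H + t ^+ 3 *: N c)).
exists (cross Q (N c) + cross U H + t *: curve_rest U H t (N c)); split.
- rewrite E !trace_mapD !trace_mapZ D0 scaler0 addr0 !trace_mapD trace_mapZ hV.
  rewrite [X in X + _ + _]cfix /r0 /r scalerN [_ - _ + _]addrAC addNr add0r.
  by rewrite addNr scaler0 addr0.
- rewrite addrC addKr; apply: le_trans (norm_le_fnorm _) _.
  rewrite mulrC; apply: (@le_trans _ _ (t * CQ)); last first.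
    by rewrite ler_wpM2l ?(ltW t0) // lerDr.
  rewrite /CQ !mulrDr; have tn := ltW t0.
  have t2 : t ^+ 2 <= t by rewrite expr2 ler_piMl // ltW.
  have t3 : t ^+ 3 <= t by rewrite exprS ler_piMr // expr_le1 // ltW.
  apply: le_trans (fnormD _ _) _; apply: lerD.
    apply: le_trans (fnormD _ _) _.
    apply: lerD; rewrite fnormZ ger0_norm ?exprn_ge0 //.
    by rewrite ler_wpM2r ?fnorm_ge0.
  rewrite fnormZ ger0_norm ?exprn_ge0 //.
  by apply: ler_pM => //; rewrite ?exprn_ge0 ?fnorm_ge0.
- exact: E.
- apply: (@le_trans _ _ CE); last by rewrite lerDl.
  apply: le_trans (ler_normD _ _) _; apply: lerD.
    apply: le_trans (ler_normD _ _) _; apply: lerD; last exact: norm_cross.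
    apply: le_trans (norm_cross _ _) _.
    by rewrite ler_wpM2l // ler_wpM2l ?fnorm_ge0.
  rewrite normrZ gtr0_norm // (le_trans _ (rest_bound t _ t01 ck)) //.
  by rewrite ler_piMl // ltW.
Qed.

End CurveExistence.

(** * Necessary conditions at a local minimizer *)

Section OptimalityConditions.
Variables (R : realType) (n p m0 : nat).
Local Notation Sn := (symmx R n).
Variables (B : 'I_m0 -> Sn) (Q : 'M[R]_(p, n)).
Hypothesis Bfree : free [tuple mxval (B i) *m (Q^T *m Q) | i < m0].
Variables (phi : Sn -> R) (G : Sn) (rho : R).
Hypothesis phiG : convex_gradient phi (gram Q) G.
Hypothesis rho0 : 0 < rho.
Hypothesis Qmin : forall Q' : 'M[R]_(p, n),
  trace_map B (gram Q') = trace_map B (gram Q) -> `|Q' - Q| < rho ->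
  phi (gram Q) <= phi (gram Q').

(** Q moves by O(t) but its Gram matrix by t^2 D + O(t^3), so the first-order majorant of phi,
    divided by t^2, already yields the sign of <G, D>. *)
Lemma second_order_condition (U H : 'M[R]_(p, n)) :
  cross Q U = 0 -> trace_map B (gram U + cross Q H) = 0 ->
  0 <= sdot G (gram U + cross Q H).
Proof.
move=> QU D0; have [C [d [C0 d0 curve]]] := constraint_curve Bfree QU D0.
move: (gram U + cross Q H) curve => D curve {D0}.
(* The term |G| C pays for t <G, E> with t <= e, and |D| + C for the error e |D + t E| of the
   majorant. *)
apply: (@ge0_of_small_perturbation _ _ (`|G| * C + (`|D| + C))) => e /andP[e0 e1].
have [eta eta0 upper] := phiG.2 e e0.
pose c := C + `|D| + 1.
have c0 : 0 < c by rewrite ltr_wpDl // addr_ge0.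
(* The constant c dominates both C, hence the displacement of Q, and |D| + C, hence the Gram
   increment; so c t < rho stays in the region of minimality and c t < eta in that of the
   majorant. *)
have [t /and5P[t0 td te trho teta]] : exists t,
    [&& 0 < t, t < d, t <= e, c * t < rho & c * t < eta].
  exists (Num.min (d / 2) (Num.min e (Num.min (rho / (2 * c)) (eta / (2 * c))))).
  have c20 : 0 < 2 * c by rewrite mulr_gt0.
  have half (x : R) : 0 < x -> x / (2 * c) < c^-1 * x.
    move=> x0; have -> : x / (2 * c) = c^-1 * (x / 2) by field; rewrite gt_eqF.
    by rewrite ltr_pM2l ?invr_gt0 // ltr_pdivrMr // ltr_pMr //; lra.
  rewrite !lt_min e0 !divr_gt0 //= !gt_min !ge_min lexx orbT /=.
  apply/and3P; split.
  - by apply/orP; left; rewrite ltr_pdivrMr // ltr_pMr //; lra.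
  - rewrite -ltr_pdivlMl // !gt_min; apply/or4P; constructor 3.
    exact: half.
  - rewrite -ltr_pdivlMl // !gt_min; apply/or4P; constructor 4.
    exact: half.
have [Q' [E [Q'M Q'Q gramQ' EC]]] := curve t (introT andP (conj t0 td)).
have t1 : t <= 1 by exact: le_trans e1.
have tn := ltW t0.
have near : `|Q' - Q| < rho.
  apply: le_lt_trans Q'Q _; apply: le_lt_trans trho.
  by rewrite ler_wpM2r // /c -addrA lerDl addr_ge0.
have := Qmin Q'M near; rewrite gramQ' -addrA.
have tE : `|t *: E| <= t * C by rewrite normrZ gtr0_norm // ler_wpM2l.
have DE : t ^+ 2 *: D + t ^+ 3 *: E = t ^+ 2 *: (D + t *: E).
  by rewrite scalerDr scalerA -exprSr.
have DEle : `|D + t *: E| <= `|D| + C.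
  apply: le_trans (ler_normD _ _) _; rewrite lerD2l; apply: le_trans tE _.
  by rewrite ler_piMl.
have small : `|t ^+ 2 *: (D + t *: E)| <= t ^+ 2 * (`|D| + C).
  by rewrite normrZ ger0_norm ?exprn_ge0 // ler_wpM2l // exprn_ge0.
rewrite DE => le; have := upper (t ^+ 2 *: (D + t *: E)).
have -> : `|t ^+ 2 *: (D + t *: E)| < eta.
  apply: le_lt_trans small _; apply: le_lt_trans teta; rewrite mulrC.
  apply: ler_pM; rewrite ?exprn_ge0 ?addr_ge0 //.
    by rewrite /c (addrC C) lerDl.
  by rewrite expr2 ler_piMl.
move=> /(_ isT) /(le_trans le); rewrite -addrA lerDl sdotZr sdotDr sdotZr.
have GE : sdot G E <= `|G| * C.
  rewrite (le_trans (ler_norm _)) // (le_trans (normr_sdot _ _)) //.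
  by rewrite ler_wpM2l.
have GEt : t * sdot G E <= e * (`|G| * C).
  have GC : 0 <= `|G| * C by rewrite mulr_ge0.
  apply: (@le_trans _ _ (t * (`|G| * C))); first by rewrite ler_wpM2l.
  by rewrite ler_wpM2r.
have es := ler_wpM2l (ltW e0) small.
move=> H0; have {H0} := le_trans H0 (lerD (lexx _) es).
rewrite mulrCA -mulrDr pmulr_rge0 ?exprn_gt0 // => H0; apply: le_trans H0 _.
by rewrite (mulrDr e (`|G| * C)) addrA lerD2r lerD2l.
Qed.

(** The inequality with U = 0, applied to H and to - H. *)
Lemma first_order_condition (H : 'M[R]_(p, n)) :
  trace_map B (cross Q H) = 0 -> sdot G (cross Q H) = 0.
Proof.
move=> BH.
have ge (K : 'M[R]_(p, n)) :
    trace_map B (cross Q K) = 0 -> 0 <= sdot G (cross Q K).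
  move=> BK; have := @second_order_condition 0 K (cross0r Q).
  by rewrite gram0 add0r => /(_ BK).
apply/eqP; rewrite eq_le ge // andbT -oppr_ge0 -sdotNr -scaleN1r -crossZr.
by apply: ge; rewrite crossZr trace_mapZ BH scaler0.
Qed.

Lemma rank_deficient_stationary (Q' : 'M[R]_(p, n)) : (\rank Q < p)%N ->
  trace_map B (gram Q') = trace_map B (gram Q) ->
  0 <= sdot G (gram Q' - gram Q).
Proof.
move=> rQ Q'M.
have [u uQ u0] : exists2 u : 'rV[R]_p, u *m Q = 0 & u != 0.
  have : kermx Q != 0.
    by rewrite -mxrank_eq0 mxrank_ker subn_eq0 -ltnNge.
  by move=> /rowV0Pn[u /sub_kermxP uQ u0]; exists u.
pose kappa : R := fdot u u.
have kappa0 : 0 < kappa.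
  rewrite lt_neqAle fdot_ge0 andbT eq_sym; apply: contra u0 => /eqP k0.
  by apply/eqP; exact: fdot_eq0.
have [V hV] := constraint_right_inverse Bfree.
pose N (d : 'cV[R]_m0) := \sum_j d j 0 *: V j.
(* Since u Q = 0, these directions satisfy [cross Q (W k) = 0], while their Gram matrices sum to
   |u|^2 times that of Q'. *)
pose W k : 'M[R]_(p, n) := u^T *m row k Q'.
have gramW k : gram (W k) = kappa *: gram (row k Q').
  apply: mxval_inj; rewrite mxvalZ /= trmx_mul trmxK -mulmxA (mulmxA u).
  rewrite [u *m u^T]mx11_scalar mul_scalar_mx -scalemxAr; congr (_ *: _).
  by rewrite /kappa /fdot mxtrace_mulC trace_mx11.
have QW k : cross Q (W k) = 0.
  apply: mxval_inj; rewrite /= /W trmx_mul trmxK -mulmxA uQ mulmx0 addr0.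
  by rewrite mulmxA -trmx_mul uQ trmx0 mul0mx.
(* The second-order correction cancelling the constraint defect of [gram (W k)]. *)
pose H k := N (- trace_map B (gram (W k))).
have BH k : trace_map B (gram (W k) + cross Q (H k)) = 0.
  by rewrite trace_mapD /H hV subrr.
have gram_rows : \sum_k gram (W k) = kappa *: gram Q'.
  rewrite (eq_bigr _ (fun k _ => gramW k)) -scaler_sumr; congr (_ *: _).
  apply: mxval_inj; rewrite mxval_sum /=; apply/matrixP => i j.
  rewrite summxE mxE; apply: eq_bigr => k _.
  by rewrite mxE big_ord1 !mxE.
have sum_ge0 : 0 <= sdot G (kappa *: gram Q' + cross Q (\sum_k H k)).
  rewrite -gram_rows cross_sumr -big_split /= sdotC sdot_suml.
  by apply: sumr_ge0 => k _; rewrite sdotC second_order_condition.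
have BsumH : trace_map B (cross Q (\sum_k H k)) =
    - (kappa *: trace_map B (gram Q')).
  rewrite cross_sumr trace_map_sum -trace_mapZ -gram_rows trace_map_sum -sumrN.
  by apply: eq_bigr => k _; rewrite /H hV.
(* As cross Q Q = 2 gram Q and Q, Q' have equal constraint values, adding (kappa / 2) Q makes the
   total correction tangent. Hence its contribution to <G, .> is - kappa <G, gram Q>. *)
have stat : sdot G (cross Q (\sum_k H k + (kappa / 2) *: Q)) = 0.
  apply: first_order_condition.
  rewrite crossDr crossZr crossxx scalerA divfK ?pnatr_eq0 // trace_mapD BsumH.
  by rewrite trace_mapZ Q'M addNr.
move: stat sum_ge0.
rewrite crossDr crossZr crossxx scalerA divfK ?pnatr_eq0 //.
rewrite !sdotDr !sdotZr sdotNr.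
move=> stat ge; rewrite -(pmulr_rge0 _ kappa0) mulrBr.
by move: stat ge; move: (sdot _ _) (_ * _) (_ * _) => a b c *; lra.
Qed.

End OptimalityConditions.

Theorem proposition3p1 (R : realType) (n m m0 p : nat) (hp : (0 < p)%N)
  (A : 'I_m -> symmx R n) (B : 'I_m0 -> symmx R n)
  (b : 'cV[R]_m) (b0 : 'cV[R]_m0)
  (f : symmx R n -> R) (h : symmx R n -> \bar R) (r : nat)
  (hA1 : assumption_A1 A B b b0 f h r)
  (hA2 : assumption_A2 B b0 p)
  (y : 'cV[R]_m) (Z : symmx R n) (sigma : R) (hsigma : 0 < sigma)
  (Q : 'M[R]_(p, n))
  (hloc : local_minimizer (setM_sdp B b0 p) (Psi A b f h y Z sigma p) Q)
  (hrank : (\rank Q < p)%N) :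
  global_minimizer (setM_sdp B b0 p) (Psi A b f h y Z sigma p) Q.
Proof.
have [_ _ [fconv [G [fG _ _]]] [hconv hlsc hproper]] := hA1.
have [phi [PhiE grad]] :=
  Phi_convex_gradient A b y Z fconv (ex_intro _ G fG) hconv hlsc hproper hsigma.
have [QM Qloc] := hloc; split; first exact: QM.
move=> Q' Q'M.
rewrite /Psi !PhiE lee_fin.
have [g phig] := grad (gram Q).
have Bfree : free [tuple mxval (B i) *m (Q^T *m Q) | i < m0].
  (* The Gram matrix of a feasible factor lies in [setD_sdp], being positive semidefinite, so the
     independence in (A2) holds there. *)
  have [free_at _ _] := hA2; apply: (free_at (gram Q)); split; last exact: QM.
  move=> u /=.
  rewrite mulmxA -mulmxA -trmx_mul mxE; apply: sumr_ge0 => i _.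
  by rewrite mxE -expr2 sqr_ge0.
move/nbhs_normP: Qloc => [rho /= rho0 rhoP].
have Qmin K : trace_map B (gram K) = trace_map B (gram Q) -> `|K - Q| < rho ->
    phi (gram Q) <= phi (gram K).
  move=> KM KQ; have := rhoP K; rewrite /ball_ /= distrC => /(_ KQ).
  by rewrite /Psi !PhiE lee_fin; apply; rewrite /setM_sdp /= KM.
(* The affine minorant at gram Q reduces the claim to <G, gram Q' - gram Q> >= 0. *)
apply: le_trans (phig.1 (gram Q')); rewrite lerDl.
apply: (rank_deficient_stationary Bfree phig rho0 Qmin hrank).
by rewrite [LHS]Q'M [RHS]QM.
Qed.
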